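(* Let $(X,d)$ be a compact metric space and let $\alpha\in\{0,c,h\}$. (1) A homeomorphism $f\colon X\to X$ has finite $\mathcal{T}_\alpha$-inverse shadowing if and only if it has $\mathcal{T}_\alpha$-inverse shadowing. (2) A continuous map $f\colon X\to X$ has finite positive $\mathcal{T}_\alpha$-inverse shadowing if and only if it has positive $\mathcal{T}_\alpha$-inverse shadowing.
   Context: $\omega=\{0,1,2,\dots\}$ and $\mathbb{N}=\{1,2,3,\dots\}$. For $\delta>0$ and a homeomorphism $f\colon X\to X$, a $\delta$-pseudo-orbit is a bi-infinite sequence $(x_k)_{k\in\mathbb{Z}}$ in $X$ with $d(f(x_k),x_{k+1})<\delta$ for all $k\in\mathbb{Z}$; for a continuous $f\colon X\to X$, a positive $\delta$-pseudo-orbit is a sequence $(x_k)_{k\in\omega}$ in $X$ with $d(f(x_k),x_{k+1})<\delta$ for all $k\in\omega$. Let $\Phi_f(\delta)\subseteq X^{\mathbb{Z}}$ (resp. $\Phi_f^+(\delta)\subseteq X^\omega$) be the set of all $\delta$-pseudo-orbits (resp. positive $\delta$-pseudo-orbits), where $X^{\mathbb{Z}}$ and $X^\omega$ carry the product topology. A $\delta$-method (resp. positive $\delta$-method) for $f$ is a map $\varphi\colon X\to\Phi_f(\delta)$ (resp. $\varphi\colon X\to\Phi_f^+(\delta)$) such that $\varphi(x)_0=x$ for every $x\in X$, where $\varphi(x)_k$ denotes the $k$-th term of $\varphi(x)$. $\mathcal{T}_0(f,\delta)$ is the set of all $\delta$-methods (resp. all positive $\delta$-methods, when the positive version is considered).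 $\mathcal{T}_c(f,\delta)$ is the set of all continuous $\delta$-methods (resp. continuous positive $\delta$-methods). $\mathcal{T}_h(f,\delta)$ is the set of all $\delta$-methods (resp. positive $\delta$-methods) $\varphi$ for which there exists a homeomorphism $h\colon X\to X$ such that $d(f(x),h(x))<\delta$ for each $x\in X$ and $\varphi(x)_k=h^k(x)$ for all $x\in X$ and all $k\in\mathbb{Z}$ (resp. $k\in\omega$). A homeomorphism (resp. continuous map) $f$ has $\mathcal{T}_\alpha$-inverse shadowing (resp. positive $\mathcal{T}_\alpha$-inverse shadowing) if for any $\varepsilon>0$ there exists $\delta>0$ such that for any $x\in X$ and any $\delta$-method (resp. positive $\delta$-method) $\varphi\in\mathcal{T}_\alpha(f,\delta)$ there exists $y\in X$ such that $d(\varphi(y)_k,f^k(x))<\varepsilon$ for all $k\in\mathbb{Z}$ (resp. $k\in\omega$). A homeomorphism (resp. continuous map) $f$ has finite (resp. finite positive) $\mathcal{T}_\alpha$-inverse shadowing if for any $\varepsilon>0$ there exists $\delta>0$ such that for any $x\in X$, any $\delta$-method (resp. positive $\delta$-method) $\varphi\in\mathcal{T}_\alpha(f,\delta)$ and any $n\in\mathbb{N}$ there exists $y_n\in X$ such that $d(f^k(x),\varphi(y_n)_k)<\varepsilon$ for any $k\in\{-n,\dots,0,\dots,n\}$ (resp. $k\in\{0,\dots,n\}$). *)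

(* Defs.v *)
From mathcomp Require Import all_boot all_order all_algebra.
From mathcomp Require Import all_classical all_reals all_analysis.

Set Implicit Arguments.
Unset Strict Implicit.
Unset Printing Implicit Defensive.

Import Order.TTheory GRing.Theory Num.Theory.

Local Open Scope classical_set_scope.
Local Open Scope ring_scope.

Record homeomorphism (X : topologicalType) := Homeomorphism {
  homeo_fun :> X -> X ;
  homeo_inv : X -> X ;
  homeo_funK : cancel homeo_fun homeo_inv ;
  homeo_invK : cancel homeo_inv homeo_fun ;
  homeo_fun_continuous : continuous homeo_fun ;
  homeo_inv_continuous : continuous homeo_inv
}.

Definition homeo_iter (X : topologicalType) (h : homeomorphism X) (k : int) :
    X -> X :=
  match k with
  | Posz n => iter n h
  | Negz n => iter n.+1 (homeo_inv h)   (* [Negz n] is the integer -(n+1) *)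
  end.

Inductive method_kind := Kind0 | KindC | KindH.

Section InverseShadowing.
Variables (R : realType) (X : metricType R).
Implicit Types (f : X -> X) (eps delta : R) (alpha : method_kind).

Definition pseudo_orbits f delta : set {ptws int -> X} :=
  [set x | forall k : int, mdist (f (x k)) (x (k + 1)) < delta].

Definition pos_pseudo_orbits f delta : set {ptws nat -> X} :=
  [set x | forall k : nat, mdist (f (x k)) (x k.+1) < delta].

Definition is_method f delta (phi : X -> {ptws int -> X}) : Prop :=
  forall x, pseudo_orbits f delta (phi x) /\ phi x 0 = x.

Definition is_pos_method f delta (phi : X -> {ptws nat -> X}) : Prop :=
  forall x, pos_pseudo_orbits f delta (phi x) /\ phi x 0%N = x.

(* Methods take their values in a set of pseudo-orbits carrying the subspace
   topology, so their continuity is continuity into the full product. *)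
Definition methods alpha f delta : set (X -> {ptws int -> X}) :=
  [set phi | is_method f delta phi /\
    match alpha with
    | Kind0 => True
    | KindC => continuous phi
    | KindH => exists h : homeomorphism X,
        (forall x, mdist (f x) (h x) < delta) /\
        (forall x (k : int), phi x k = homeo_iter h k x)
    end].

Definition pos_methods alpha f delta : set (X -> {ptws nat -> X}) :=
  [set phi | is_pos_method f delta phi /\
    match alpha with
    | Kind0 => True
    | KindC => continuous phi
    | KindH => exists h : homeomorphism X,
        (forall x, mdist (f x) (h x) < delta) /\
        (forall x (k : nat), phi x k = iter k h x)
    end].

Definition inverse_shadowing alpha (f : homeomorphism X) : Prop :=
  forall eps, 0 < eps -> exists delta, 0 < delta /\
    forall (x : X) phi, methods alpha f delta phi ->
      exists y : X, forall k : int,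
        mdist (phi y k) (homeo_iter f k x) < eps.

Definition pos_inverse_shadowing alpha f : Prop :=
  forall eps, 0 < eps -> exists delta, 0 < delta /\
    forall (x : X) phi, pos_methods alpha f delta phi ->
      exists y : X, forall k : nat,
        mdist (phi y k) (iter k f x) < eps.

Definition finite_inverse_shadowing alpha (f : homeomorphism X) : Prop :=
  forall eps, 0 < eps -> exists delta, 0 < delta /\
    forall (x : X) phi, methods alpha f delta phi ->
      forall n : nat, (0 < n)%N ->
        exists y : X, forall k : int, - n%:Z <= k <= n%:Z ->
          mdist (homeo_iter f k x) (phi y k) < eps.

Definition finite_pos_inverse_shadowing alpha f : Prop :=
  forall eps, 0 < eps -> exists delta, 0 < delta /\
    forall (x : X) phi, pos_methods alpha f delta phi ->
      forall n : nat, (0 < n)%N ->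
        exists y : X, forall k : nat, (k <= n)%N ->
          mdist (iter k f x) (phi y k) < eps.

End InverseShadowing.

(* Main.v *)
Require Import Defs.
From mathcomp Require Import all_boot all_order all_algebra.
From mathcomp Require Import all_classical all_reals all_analysis.
From mathcomp Require Import zify.

(** Only the passage from finite to full shadowing needs an argument: a point
    that shadows the whole orbit shadows each finite part of it.

    Fix a target orbit [t] and, for each time [k], let [E k] be the set of the
    starting points that are good at time [k].  Finite shadowing says that the
    sets [E k], for [k] in a finite window, always have a common point.  As [X]
    is compact, some [y] lies in the closure of every [E k]
    ([compact_windows]), and it remains to see that such a [y] is good itself,
    at the cost of weakening [< eps] to [<= eps].

    For methods all of whose coordinates are continuous, which covers the kinds
    [c] and [h], take for [E k] the points at which the given method is good at
    time [k]; continuity of its [k]-th coordinate lets the estimate pass to the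
    closure ([continuous_shadowing]).

    For arbitrary methods this fails, since a method may jump at [y].  But
    arbitrary methods choose the pseudo-orbit of each point independently, so
    finite shadowing by all of them provides, for each window, a point [y_n]
    such that EVERY [delta]-pseudo-orbit from [y_n] is good on the window:
    otherwise choosing a bad pseudo-orbit from each point would give a method
    contradicting finite shadowing.  Then take for [E k] the points all of whose
    [delta]-pseudo-orbits are good at time [k].  Given a [delta/2]-pseudo-orbit
    [z] from a point [y] of the closure, replace its initial term by some [y']
    in [E k] close to [y].  By continuity of [f] at [y] the result is a
    [delta]-pseudo-orbit from [y'], hence good at time [k], and it differs from
    [z] only at time 0, where the two terms are close
    ([pseudo_orbit_shadowing]).

    Two-sided and one-sided sequences are treated together, as families over an
    index type with an initial index and a successor map without fixed
    points. *)

Set Implicit Arguments.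
Unset Strict Implicit.
Unset Printing Implicit Defensive.

Import Order.TTheory GRing.Theory Num.Theory.

Local Open Scope classical_set_scope.
Local Open Scope ring_scope.

(** The windows are only required to be directed and to cover the index type,
    so that this applies to [{-n, ..., n}] and [{0, ..., n}] alike. *)
Lemma compact_windows (X : topologicalType) (I : Type) (W : nat -> set I)
    (E : I -> set X) :
  compact [set: X] ->
  (forall m n, (m <= n)%N -> W m `<=` W n) -> (forall k, exists n, W n k) ->
  (forall n, exists y, forall k, W n k -> E k y) ->
  exists y, forall k, closure (E k) y.
Proof.
move=> hX Wmono Wcov Ene.
pose A n := [set y | forall k, W n k -> E k y].
have FA : ProperFilter (filter_from [set: nat] A).
  apply: filter_from_proper => [|n _]; last by have [y yE] := Ene n; exists y.
  apply: filter_from_filter; first by exists 0%N.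
  move=> m n _ _; exists (maxn m n) => // y yA.
  by split=> k Wk; apply: yA; apply: Wmono Wk; rewrite ?leq_maxl ?leq_maxr.
have [|y [_ Fy]] := hX _ FA; first by exists 0%N.
exists y => k B By; have [n Wnk] := Wcov k.
have [|z [zE Bz]] := Fy (E k) B _ By; last by exists z.
by exists n => // z; apply.
Qed.

Section Shadowing.
Context {R : realType} {X : metricType R} {I : eqType}.
Variables (o : I) (s : I -> I) (W : nat -> set I).
Hypothesis hX : compact [set: X].
Hypothesis Wmono : forall m n, (m <= n)%N -> W m `<=` W n.
Hypothesis Wcov : forall k, exists n, W n k.

Lemma near_mdist (x : X) (e : R) : 0 < e -> nbhs x [set y | mdist x y < e].
Proof. by move=> e0; rewrite -ballEmdist; exact: nbhsx_ballx. Qed.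

Lemma continuous_shadowing (phi : X -> I -> X) (t : I -> X) (e : R) :
  (forall k, continuous (phi^~ k)) ->
  (forall n, exists y, forall k, W n k -> mdist (t k) (phi y k) < e) ->
  exists y, forall k, mdist (phi y k) (t k) <= e.
Proof.
move=> cphi Hfin.
have [y yE] := compact_windows
  (E := fun k => [set y | mdist (t k) (phi y k) < e]) hX Wmono Wcov Hfin.
exists y => k; apply/ler_addgt0Pr => r r0.
have [y' [/= ty' yy']] := yE k _ (cphi k y _ (near_mdist (phi y k) r0)).
rewrite (le_trans (metric_triangle _ (phi y' k) _))// addrC.
by rewrite lerD ?(ltW yy')// metric_sym ltW.
Qed.

(** Pseudo-orbits along the successor map [s]; for [k |-> k + 1] on [int] and
    [S] on [nat] these are the two-sided and the one-sided ones. *)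
Definition step_orbit (f : X -> X) (delta : R) : set (I -> X) :=
  [set z | forall k, mdist (f (z k)) (z (s k)) < delta].

Hypothesis sN : forall k, s k != k.

(** The absence of fixed points of [s] ensures that each step involves the
    modified term at most once. *)
Lemma step_orbit_change_start (f : X -> X) (delta : R) (z : I -> X) (y : X) :
  step_orbit f (delta / 2) z ->
  mdist (z o) y < delta / 2 -> mdist (f (z o)) (f y) < delta / 2 ->
  step_orbit f delta (fun k => if k == o then y else z k).
Proof.
move=> zf zy fzy k /=; case: (eqVneq k o) => [->|ko].
  rewrite (negPf (sN o)) (le_lt_trans (metric_triangle _ (f (z o)) _))//.
  by rewrite [ltRHS]splitr ltrD// metric_sym.
case: (eqVneq (s k) o) => [sk|_].
  rewrite (le_lt_trans (metric_triangle _ (z o) _))// [ltRHS]splitr ltrD//.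
  by rewrite -sk zf.
rewrite (lt_trans (zf k))// [ltRHS]splitr ltrDl.
exact: le_lt_trans (mdist_ge0 _ _) zy.
Qed.

(** The conclusion speaks of pseudo-orbits, not of a method, because a
    discontinuous method at a limit point is unrelated to its values nearby;
    halving [delta] pays for moving the initial term onto a nearby point. *)
Lemma pseudo_orbit_shadowing (f : X -> X) (t : I -> X) (delta e : R) :
  continuous f -> 0 < delta ->
  (forall phi : X -> I -> X,
    (forall x, step_orbit f delta (phi x) /\ phi x o = x) ->
    forall n, exists y, forall k, W n k -> mdist (t k) (phi y k) < e) ->
  exists y, forall z, step_orbit f (delta / 2) z -> z o = y ->
    forall k, mdist (z k) (t k) <= e.
Proof.
move=> cf d0 Hfin.
pose E k := [set y | forall z, step_orbit f delta z -> z o = y ->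
  mdist (t k) (z k) < e].
have [|y yE] := compact_windows (E := E) hX Wmono Wcov.
  move=> n; apply: contrapT => /forallNP noy.
  (* the worst method: from each point, a pseudo-orbit bad on the window *)
  have bad y : exists z, (step_orbit f delta z /\ z o = y) /\
      exists2 k, W n k & ~ (mdist (t k) (z k) < e).
    apply: contrapT => /forallNP noz; apply: (noy y) => k Wk z zf zy.
    by apply: contrapT => zk; apply: (noz z); split => //; exists k.
  have [phi phiP] := choice bad.
  have [y yW] := Hfin phi (fun y => (phiP y).1) n.
  by have [k Wk] := (phiP y).2; apply; exact: yW.
exists y => z zf zo k; apply/ler_addgt0Pr => r r0.
have d20 : 0 < delta / 2 by rewrite divr_gt0.
have [y' [Ey' [[/= yy' yr] fy]]] := yE k _ (filterI
  (filterI (near_mdist y d20) (near_mdist y r0))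
  (cf y _ (near_mdist (f y) d20))).
have z'f : step_orbit f delta (fun k => if k == o then y' else z k).
  by apply: step_orbit_change_start; rewrite ?zo.
have /= := Ey' _ z'f; rewrite eqxx => /(_ erefl).
case: (eqVneq k o) => [->|_] zk; last first.
  by rewrite metric_sym ltW// (lt_trans zk)// ltrDl.
rewrite zo (le_trans (metric_triangle _ y' _))// addrC.
by rewrite lerD ?(ltW yr)// metric_sym ltW.
Qed.

End Shadowing.

Lemma continuous_iter (X : topologicalType) (h : X -> X) n :
  continuous h -> continuous (iter n h).
Proof.
move=> ch; elim: n => [|n IHn] x /=; first exact: cvg_id.
exact: (continuous_comp (IHn x) (ch _)).
Qed.

Lemma continuous_homeo_iter (X : topologicalType) (h : homeomorphism X) k :
  continuous (homeo_iter h k).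
Proof.
case: k => n.
  exact: (continuous_iter (n := n) (homeo_fun_continuous (h := h))).
exact: (continuous_iter (n := n.+1) (homeo_inv_continuous (h := h))).
Qed.

Lemma continuous_coordinate (X Y : topologicalType) (I : choiceType)
    (phi : X -> {ptws I -> Y}) (k : I) :
  continuous phi -> continuous (phi^~ k).
Proof.
move=> cphi x.
exact: (continuous_comp (cphi x) (@proj_continuous I (fun=> Y) k (phi x))).
Qed.

Lemma finite_inverse_shadowingP (R : realType) (X : metricType R)
    (alpha : method_kind) (f : homeomorphism X) : compact [set: X] ->
  finite_inverse_shadowing alpha f -> inverse_shadowing alpha f.
Proof.
move=> hX fin eps e0; have e20 : 0 < eps / 2 by rewrite divr_gt0.
have e2e : eps / 2 < eps by rewrite ltr_pdivrMr// mulr_natr mulr2n ltrDl.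
have [delta [d0 Hd]] := fin _ e20.
(* windows start at 1, as finite shadowing speaks of positive n only *)
pose W (n : nat) := [set k : int | - n.+1%:Z <= k <= n.+1%:Z].
have Wmono m n : (m <= n)%N -> W m `<=` W n by rewrite /W => mn k /=; lia.
have Wcov k : exists n, W n k by exists `|k|%N; rewrite /W /=; lia.
have sN (k : int) : k + 1 != k by lia.
have Hc x phi : (forall k, continuous (phi^~ k : X -> X)) ->
    methods alpha f delta phi ->
    exists y, forall k, mdist (phi y k) (homeo_iter f k x) < eps.
  move=> cphi mphi.
  have [y yP] := continuous_shadowing hX Wmono Wcov cphi
    (fun n => Hd x phi mphi n.+1 isT).
  by exists y => k; exact: le_lt_trans (yP k) e2e.
case: alpha fin Hd Hc => _ Hd Hc.
- exists (delta / 2); split; first by rewrite divr_gt0.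
  move=> x phi [mphi _].
  have [|y yP] := pseudo_orbit_shadowing (o := 0) (t := (homeo_iter f)^~ x)
    (e := eps / 2) hX Wmono Wcov sN (homeo_fun_continuous (h := f)) d0.
    by move=> psi mpsi n; exact: Hd.
  exists y => k; apply: le_lt_trans e2e.
  by apply: yP; have [] := mphi y.
- exists delta; split=> // x phi mphi; apply: Hc => //.
  by move=> k; apply: continuous_coordinate; case: mphi.
- exists delta; split=> // x phi mphi; apply: Hc => // k.
  have [_ [h [_ hE]]] := mphi.
  have -> : phi^~ k = homeo_iter h k by apply/funext => y.
  exact: continuous_homeo_iter.
Qed.

Lemma finite_pos_inverse_shadowingP (R : realType) (X : metricType R)
    (alpha : method_kind) (f : X -> X) : compact [set: X] -> continuous f ->
  finite_pos_inverse_shadowing alpha f -> pos_inverse_shadowing alpha f.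
Proof.
move=> hX cf fin eps e0; have e20 : 0 < eps / 2 by rewrite divr_gt0.
have e2e : eps / 2 < eps by rewrite ltr_pdivrMr// mulr_natr mulr2n ltrDl.
have [delta [d0 Hd]] := fin _ e20.
pose W (n : nat) := [set k : nat | (k <= n.+1)%N].
have Wmono m n : (m <= n)%N -> W m `<=` W n by rewrite /W => mn k /=; lia.
have Wcov k : exists n, W n k by exists k; rewrite /W /=; lia.
have sN (k : nat) : k.+1 != k by lia.
have Hc x phi : (forall k, continuous (phi^~ k : X -> X)) ->
    pos_methods alpha f delta phi ->
    exists y, forall k, mdist (phi y k) (iter k f x) < eps.
  move=> cphi mphi.
  have [y yP] := continuous_shadowing hX Wmono Wcov cphi
    (fun n => Hd x phi mphi n.+1 isT).
  by exists y => k; exact: le_lt_trans (yP k) e2e.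
case: alpha fin Hd Hc => _ Hd Hc.
- exists (delta / 2); split; first by rewrite divr_gt0.
  move=> x phi [mphi _].
  have [|y yP] := pseudo_orbit_shadowing (o := 0%N)
    (t := fun k => iter k f x) (e := eps / 2) hX Wmono Wcov sN cf d0.
    by move=> psi mpsi n; exact: Hd.
  exists y => k; apply: le_lt_trans e2e.
  by apply: yP; have [] := mphi y.
- exists delta; split=> // x phi mphi; apply: Hc => //.
  by move=> k; apply: continuous_coordinate; case: mphi.
- exists delta; split=> // x phi mphi; apply: Hc => // k.
  have [_ [h [_ hE]]] := mphi.
  have -> : phi^~ k = iter k h by apply/funext => y.
  by apply: continuous_iter; exact: homeo_fun_continuous.
Qed.

Theorem proposition3p7 (R : realType) (X : metricType R)
    (hX : compact [set: X]) (alpha : method_kind) :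
  (forall f : homeomorphism X,
     finite_inverse_shadowing alpha f <-> inverse_shadowing alpha f) /\
  (forall f : X -> X, continuous f ->
     (finite_pos_inverse_shadowing alpha f <-> pos_inverse_shadowing alpha f)).
Proof.
split=> [f|f cf]; (split; first by
  [exact: finite_inverse_shadowingP | exact: finite_pos_inverse_shadowingP]);
  move=> sh eps e0; have [delta [d0 Hd]] := sh _ e0; exists delta; split=> //;
  move=> x phi mphi n _; have [y yP] := Hd x phi mphi;
  by exists y => k _; rewrite metric_sym.
Qed.
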